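(* There are exactly $252$ $4$-unital functions, and the set $\mathsf{U}_4$ of all $4$-unital functions is \[ \mathsf{U}_4 = O(x)\cup O(x^2)\cup O(x^4)\cup O\!\left(\tfrac{2x}{x^2+1}\right)\cup \left\langle \tfrac{4x^2}{(x^2+1)^2}\right\rangle_6 \cup O\!\left(\tfrac{2x}{x+1}\right)\cup O\!\left(\tfrac{x(x-1)}{x^2+1}\right)\cup O\!\left(\tfrac{2(1+i)x}{(x+1)(x+i)}\right), \] where \begin{align*} O(x)&=\bigcup_{\varepsilon\in\{1,-1,i,-i\}} \langle \varepsilon x\rangle_6\cup \left\langle \tfrac{i(\varepsilon x+1)}{\varepsilon x-1}\right\rangle_6\cup\left\langle \tfrac{\varepsilon x+1}{\varepsilon x+i}\right\rangle_6,\\ O(x^2)&=\bigcup_{\varepsilon=\pm1} \langle \varepsilon x^2\rangle_6\cup \left\langle \varepsilon\left(\tfrac{x-1}{x+1}\right)^2\right\rangle_6\cup\left\langle \varepsilon\left(\tfrac{x-i}{x+i}\right)^2\right\rangle_6,\\ O(x^4)&=\langle x^4\rangle_6\cup \left\langle \left(\tfrac{x+1}{x-1}\right)^4\right\rangle_6\cup\left\langle \left(\tfrac{x-i}{x+i}\right)^4\right\rangle_6,\\ O\!\left(\tfrac{2x}{x^2+1}\right)&=\bigcup_{\varepsilon=\pm1} \left\langle \tfrac{2\varepsilon x}{x^2+1}\right\rangle_6\cup \left\langle \tfrac{2\varepsilon i x}{x^2-1}\right\rangle_6\cup\left\langle \tfrac{\varepsilon(x^2-1)}{x^2+1}\right\rangle_6,\\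 O\!\left(\tfrac{2x}{x+1}\right)&=\bigcup_{\varepsilon=\pm1} \left\langle \tfrac{\varepsilon(x-1)}{x+1}\right\rangle_6\cup \left\langle \tfrac{\varepsilon(x-i)}{x+i}\right\rangle_6\cup\left\langle \tfrac{(1-i)x}{x+\varepsilon}\right\rangle_6\cup\left\langle \tfrac{(1+i)x}{x+\varepsilon}\right\rangle_6,\\ O\!\left(\tfrac{x(x-1)}{x^2+1}\right)&=\left\langle \tfrac{x(x-1)}{x^2+1}\right\rangle_6\cup\left\langle \tfrac{x(x+1)}{x^2+1}\right\rangle_6\cup\left\langle \tfrac{x(x-i)}{x^2-1}\right\rangle_6\cup\left\langle \tfrac{x(x+i)}{x^2-1}\right\rangle_6,\\ O\!\left(\tfrac{2(1+i)x}{(x+1)(x+i)}\right)&=\left\langle \tfrac{2(1+i)x}{(x+1)(x+i)}\right\rangle_6\cup\left\langle \tfrac{2(1-i)x}{(x+1)(x-i)}\right\rangle_6. \end{align*}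
   Context: Let $N$ be a positive integer. A non-constant rational function $U(x)\in\mathbb{C}(x)$ is called $N$-unital if all the zeros and poles (in $\mathbb{C}$) of both $U(x)$ and $1-U(x)$ are either $0$ or $N$-th roots of unity. For a rational function $f$, its $S_3$-orbit is the set \[ \langle f\rangle_6=\left\{ f,\ 1-f,\ \tfrac{1}{f},\ \tfrac{f}{f-1},\ \tfrac{f-1}{f},\ \tfrac{-1}{f-1}\right\}. \] Here $i=\sqrt{-1}$. *)

(* Defs.v *)
From mathcomp Require Import all_boot all_order all_algebra.
From mathcomp Require Import all_classical reals.
From mathcomp Require Import complex.

Set Implicit Arguments.
Unset Strict Implicit.
Unset Printing Implicit Defensive.

Import Order.TTheory GRing.Theory Num.Theory.

Local Open Scope classical_set_scope.
Local Open Scope ring_scope.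

Local Notation "p %:F" := (FracField.tofrac p) : ring_scope.

Section Unital.
Variable F : fieldType.
Implicit Types (U f : {fraction {poly F}}) (z : F) (N : nat).

Definition ratconst (c : F) : {fraction {poly F}} := (c%:P)%:F.

Definition ratX : {fraction {poly F}} := ('X)%:F.

Definition is_zero U z : Prop :=
  exists p q : {poly F}, [/\ U = p%:F / q%:F, root p z & ~~ root q z].

(* [q != 0] is needed because [p / 0 = 0] in MathComp. *)
Definition is_pole U z : Prop :=
  exists p q : {poly F},
    [/\ q != 0, U = p%:F / q%:F, ~~ root p z & root q z].

Definition is_constant U : Prop := exists c, U = ratconst c.

Definition unital N U : Prop :=
  ~ is_constant U /\
  forall z, is_zero U z \/ is_pole U z \/
            is_zero (1 - U) z \/ is_pole (1 - U) z ->
    z = 0 \/ N.-unity_root z.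

Definition unital_set N : set {fraction {poly F}} := [set U | unital N U].

Definition orbit6 f : set {fraction {poly F}} :=
  [set f; 1 - f; 1 / f; f / (f - 1); (f - 1) / f; - 1 / (f - 1)].

End Unital.

Arguments ratX : clear implicits.

Section Orbits.
Variable R : realType.
Local Notation ratfun := {fraction {poly R[i]}}.
Local Notation x := (ratX R[i]).
Local Notation I := (@ratconst R[i] 'i%C).

Definition O_x : set ratfun :=
  \bigcup_(e in [set 1; -1; I; - I])
    (orbit6 (e * x)
     `|` orbit6 (I * (e * x + 1) / (e * x - 1))
     `|` orbit6 ((e * x + 1) / (e * x + I))).

Definition O_x2 : set ratfun :=
  \bigcup_(e in [set 1; -1])
    (orbit6 (e * x ^+ 2)
     `|` orbit6 (e * ((x - 1) / (x + 1)) ^+ 2)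
     `|` orbit6 (e * ((x - I) / (x + I)) ^+ 2)).

Definition O_x4 : set ratfun :=
  orbit6 (x ^+ 4)
  `|` orbit6 (((x + 1) / (x - 1)) ^+ 4)
  `|` orbit6 (((x - I) / (x + I)) ^+ 4).

(* O(2x / (x^2 + 1)) *)
Definition O_2x_x2p1 : set ratfun :=
  \bigcup_(e in [set 1; -1])
    (orbit6 (2 * e * x / (x ^+ 2 + 1))
     `|` orbit6 (2 * e * I * x / (x ^+ 2 - 1))
     `|` orbit6 (e * (x ^+ 2 - 1) / (x ^+ 2 + 1))).

(* O(2x / (x + 1)) *)
Definition O_2x_xp1 : set ratfun :=
  \bigcup_(e in [set 1; -1])
    (orbit6 (e * (x - 1) / (x + 1))
     `|` orbit6 (e * (x - I) / (x + I))
     `|` orbit6 ((1 - I) * x / (x + e))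
     `|` orbit6 ((1 + I) * x / (x + e))).

(* O(x(x - 1) / (x^2 + 1)) *)
Definition O_xxm1_x2p1 : set ratfun :=
  orbit6 (x * (x - 1) / (x ^+ 2 + 1))
  `|` orbit6 (x * (x + 1) / (x ^+ 2 + 1))
  `|` orbit6 (x * (x - I) / (x ^+ 2 - 1))
  `|` orbit6 (x * (x + I) / (x ^+ 2 - 1)).

(* O(2(1 + i)x / ((x + 1)(x + i))) *)
Definition O_2x_xp1xpi : set ratfun :=
  orbit6 (2 * (1 + I) * x / ((x + 1) * (x + I)))
  `|` orbit6 (2 * (1 - I) * x / ((x + 1) * (x - I))).

Definition orbit_4x2 : set ratfun :=
  orbit6 (4 * x ^+ 2 / (x ^+ 2 + 1) ^+ 2).

End Orbits.

Arguments O_x : clear implicits.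
Arguments O_x2 : clear implicits.
Arguments O_x4 : clear implicits.
Arguments O_2x_x2p1 : clear implicits.
Arguments orbit_4x2 : clear implicits.
Arguments O_2x_xp1 : clear implicits.
Arguments O_xxm1_x2p1 : clear implicits.
Arguments O_2x_xp1xpi : clear implicits.

(* Main.v *)
(** A 4-unital function U = P / Q in lowest terms gives a relation
    a A + b B = c C with P = a A, 1 - U = b B / Q, Q = c C, where A, B, C are
    pairwise coprime monic polynomials with all roots in {0, 1, -1, i, -i}, the
    roots of T = X (X^4 - 1).  As in the Mason-Stothers theorem, the Wronskian
    of P and Q times T is a nonzero multiple of A B C, which bounds all three
    degrees by deg T - 1 = 4.  This leaves finitely many triples of exponent
    vectors of A, B, C.  The coefficient vectors of A, B, C are linearly
    dependent, hence all 3 x 3 minors of a matrix over Z[i] vanish, and a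
    search over all triples leaves 252 of them: the 42 given by the listed
    functions f (from f and 1 - f) and their permutations, which match the
    six members of the orbit of f.  Finally U is determined by its triple,
    since V = s U and 1 - V = t (1 - U) with U nonconstant force s = t = 1. *)
From Stdlib Require Import ZArith.
Require Import Defs.
From mathcomp Require Import all_boot all_order all_algebra.
From mathcomp Require Import all_classical reals.
From mathcomp Require Import complex.
From mathcomp Require Import ssrZ ring zify.

Set Implicit Arguments.
Unset Strict Implicit.
Unset Printing Implicit Defensive.

Import Order.TTheory GRing.Theory Num.Theory.

(** * The finite search *)

(* [(a, b, c)] lists the multiplicities at 0, 1, -1, i, -i (in this order) of
   the numerators of [f] and of [1 - f] and of their common denominator. *)
Definition triple : Type := (seq nat * seq nat * seq nat)%type.

(** The order is that of the members of [orbit6]: [1 - f] swaps the first two vectors, [1 / f] the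
    first and the last, and these two moves generate the rest. *)
Definition S3_orbit (t : triple) : seq triple :=
  let: (a, b, c) := t in
  [:: (a, b, c); (b, a, c); (c, b, a); (a, c, b); (b, c, a); (c, a, b)].

(** One triple for each listed function, in the order of [rows], whose entries carry the matching
    constant factors. *)
Definition base_triples : seq triple :=
  [:: ([:: 1; 0; 0; 0; 0], [:: 0; 1; 0; 0; 0], [:: 0; 0; 0; 0; 0]);
      ([:: 0; 0; 1; 0; 0], [:: 0; 0; 0; 1; 0], [:: 0; 1; 0; 0; 0]);
      ([:: 0; 0; 1; 0; 0], [:: 0; 0; 0; 0; 0], [:: 0; 0; 0; 0; 1]);
      ([:: 1; 0; 0; 0; 0], [:: 0; 0; 1; 0; 0], [:: 0; 0; 0; 0; 0]);
      ([:: 0; 1; 0; 0; 0], [:: 0; 0; 0; 0; 1], [:: 0; 0; 1; 0; 0]);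
      ([:: 0; 1; 0; 0; 0], [:: 0; 0; 0; 0; 0], [:: 0; 0; 0; 1; 0]);
      ([:: 1; 0; 0; 0; 0], [:: 0; 0; 0; 0; 1], [:: 0; 0; 0; 0; 0]);
      ([:: 0; 0; 0; 1; 0], [:: 0; 1; 0; 0; 0], [:: 0; 0; 0; 0; 1]);
      ([:: 0; 0; 0; 1; 0], [:: 0; 0; 0; 0; 0], [:: 0; 0; 1; 0; 0]);
      ([:: 1; 0; 0; 0; 0], [:: 0; 0; 0; 1; 0], [:: 0; 0; 0; 0; 0]);
      ([:: 0; 0; 0; 0; 1], [:: 0; 0; 1; 0; 0], [:: 0; 0; 0; 1; 0]);
      ([:: 0; 0; 0; 0; 1], [:: 0; 0; 0; 0; 0], [:: 0; 1; 0; 0; 0]);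
      ([:: 2; 0; 0; 0; 0], [:: 0; 1; 1; 0; 0], [:: 0; 0; 0; 0; 0]);
      ([:: 0; 2; 0; 0; 0], [:: 1; 0; 0; 0; 0], [:: 0; 0; 2; 0; 0]);
      ([:: 0; 0; 0; 2; 0], [:: 1; 0; 0; 0; 0], [:: 0; 0; 0; 0; 2]);
      ([:: 2; 0; 0; 0; 0], [:: 0; 0; 0; 1; 1], [:: 0; 0; 0; 0; 0]);
      ([:: 0; 2; 0; 0; 0], [:: 0; 0; 0; 1; 1], [:: 0; 0; 2; 0; 0]);
      ([:: 0; 0; 0; 2; 0], [:: 0; 1; 1; 0; 0], [:: 0; 0; 0; 0; 2]);
      ([:: 4; 0; 0; 0; 0], [:: 0; 1; 1; 1; 1], [:: 0; 0; 0; 0; 0]);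
      ([:: 0; 0; 4; 0; 0], [:: 1; 0; 0; 1; 1], [:: 0; 4; 0; 0; 0]);
      ([:: 0; 0; 0; 4; 0], [:: 1; 1; 1; 0; 0], [:: 0; 0; 0; 0; 4]);
      ([:: 1; 0; 0; 0; 0], [:: 0; 2; 0; 0; 0], [:: 0; 0; 0; 1; 1]);
      ([:: 1; 0; 0; 0; 0], [:: 0; 0; 0; 2; 0], [:: 0; 1; 1; 0; 0]);
      ([:: 0; 1; 1; 0; 0], [:: 0; 0; 0; 0; 0], [:: 0; 0; 0; 1; 1]);
      ([:: 1; 0; 0; 0; 0], [:: 0; 0; 2; 0; 0], [:: 0; 0; 0; 1; 1]);
      ([:: 1; 0; 0; 0; 0], [:: 0; 0; 0; 0; 2], [:: 0; 1; 1; 0; 0]);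
      ([:: 0; 1; 1; 0; 0], [:: 2; 0; 0; 0; 0], [:: 0; 0; 0; 1; 1]);
      ([:: 2; 0; 0; 0; 0], [:: 0; 2; 2; 0; 0], [:: 0; 0; 0; 2; 2]);
      ([:: 0; 1; 0; 0; 0], [:: 0; 0; 0; 0; 0], [:: 0; 0; 1; 0; 0]);
      ([:: 0; 0; 0; 1; 0], [:: 0; 0; 0; 0; 0], [:: 0; 0; 0; 0; 1]);
      ([:: 1; 0; 0; 0; 0], [:: 0; 0; 0; 1; 0], [:: 0; 0; 1; 0; 0]);
      ([:: 1; 0; 0; 0; 0], [:: 0; 0; 0; 0; 1], [:: 0; 0; 1; 0; 0]);
      ([:: 0; 1; 0; 0; 0], [:: 1; 0; 0; 0; 0], [:: 0; 0; 1; 0; 0]);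
      ([:: 0; 0; 0; 1; 0], [:: 1; 0; 0; 0; 0], [:: 0; 0; 0; 0; 1]);
      ([:: 1; 0; 0; 0; 0], [:: 0; 0; 0; 0; 1], [:: 0; 1; 0; 0; 0]);
      ([:: 1; 0; 0; 0; 0], [:: 0; 0; 0; 1; 0], [:: 0; 1; 0; 0; 0]);
      ([:: 1; 1; 0; 0; 0], [:: 0; 0; 1; 0; 0], [:: 0; 0; 0; 1; 1]);
      ([:: 1; 0; 1; 0; 0], [:: 0; 1; 0; 0; 0], [:: 0; 0; 0; 1; 1]);
      ([:: 1; 0; 0; 1; 0], [:: 0; 0; 0; 0; 1], [:: 0; 1; 1; 0; 0]);
      ([:: 1; 0; 0; 0; 1], [:: 0; 0; 0; 1; 0], [:: 0; 1; 1; 0; 0]);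
      ([:: 1; 0; 0; 0; 0], [:: 0; 1; 0; 1; 0], [:: 0; 0; 1; 0; 1]);
      ([:: 1; 0; 0; 0; 0], [:: 0; 1; 0; 0; 1], [:: 0; 0; 1; 1; 0])].

Definition unital_triples : seq triple := flatten (map S3_orbit base_triples).

Fixpoint exponents n d : seq (seq nat) :=
  if n is n'.+1 then
    [seq k :: e | k <- iota 0 d.+1, e <- exponents n' (d - k)]
  else [:: [::]].

Definition disj (e e' : seq nat) : bool :=
  all2 (fun m n => (m == 0) || (n == 0)) e e'.

(* Gaussian integers u + i v as pairs of binary integers. *)
Definition zi : Type := (Z * Z)%type.

Definition zi_add (x y : zi) : zi := (Z.add x.1 y.1, Z.add x.2 y.2).

Definition zi_opp (x : zi) : zi := (Z.opp x.1, Z.opp x.2).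

Definition zi_mul (x y : zi) : zi :=
  (Z.sub (Z.mul x.1 y.1) (Z.mul x.2 y.2), Z.add (Z.mul x.1 y.2) (Z.mul x.2 y.1)).

Definition zi0 : zi := (Z0, Z0).

Definition zi1 : zi := (Z.pos xH, Z0).

Definition zi_is0 (x : zi) : bool := Z.eqb x.1 Z0 && Z.eqb x.2 Z0.

Definition zi_roots : seq zi :=
  [:: zi0; zi1; (Z.neg xH, Z0); (Z0, Z.pos xH); (Z0, Z.neg xH)].

(* The coefficients of c + (X - s) p, from those of p. *)
Fixpoint mulXsub (s c : zi) (p : seq zi) : seq zi :=
  if p is a :: p' then zi_add c (zi_opp (zi_mul s a)) :: mulXsub s a p' else [:: c].

Definition zpol (e : seq nat) : seq zi :=
  foldr (fun (sk : zi * nat) (p : seq zi) => iter sk.2 (mulXsub sk.1 zi0) p)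
    [:: zi1] (zip zi_roots e).

(** The determinant of the columns [i], [j], [k] of the matrix with rows [p], [q], [r], expanded
    along [r]. *)
Definition minor (p q r : seq zi) (i j k : nat) : zi :=
  let c p i := nth zi0 p i in
  let m p q i j := zi_add (zi_mul (c p i) (c q j)) (zi_opp (zi_mul (c p j) (c q i))) in
  zi_add (zi_mul (c r k) (m p q i j))
  (zi_add (zi_mul (c r i) (m p q j k)) (zi_opp (zi_mul (c r j) (m p q i k)))).

(** The ten index triples exhaust the choices of three columns among 0 to 4, which hold all
    coefficients of polynomials of degree at most 4. *)
Definition independent (p q r : seq zi) : bool :=
  has (fun ijk => ~~ zi_is0 (minor p q r ijk.1.1 ijk.1.2 ijk.2))
    [:: (0, 1, 2); (0, 1, 3); (0, 1, 4); (0, 2, 3); (0, 2, 4);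
        (0, 3, 4); (1, 2, 3); (1, 2, 4); (1, 3, 4); (2, 3, 4)].

(* The necessary condition on the degrees of A, B, C in a nontrivial relation
   a A + b B = c C: the two largest coincide. *)
Definition two_max (a b c : nat) : bool :=
  [&& a <= maxn b c, b <= maxn a c, c <= maxn a b & maxn a b != 0].

(** The bound 4 is the one of [pol_mason]; degree and coefficients are stored with each exponent
    vector. *)
Definition candidates : seq (seq nat * nat * seq zi) :=
  [seq (e, sumn e, zpol e) | e <- exponents 5 4].

(** The cheap tests on supports and degrees precede the minors, which are then evaluated only for
    the triples that pass them. *)
Definition search : bool :=
  all (fun a =>
    let cs := [seq b <- candidates | disj a.1.1 b.1.1] in
    all (fun b =>
      all (fun c =>
        [|| ~~ disj a.1.1 c.1.1, ~~ disj b.1.1 c.1.1, ~~ two_max a.1.2 b.1.2 c.1.2,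
            independent a.2 b.2 c.2 | (a.1.1, b.1.1, c.1.1) \in unital_triples])
      cs) cs) candidates.

(* [lazy] only: the virtual machine would evaluate every disjunct. *)
Lemma searchP : search. Proof. by lazy. Qed.

Arguments exponents : simpl never.
Arguments zpol : simpl never.

Lemma uniq_unital_triples : uniq unital_triples. Proof. by vm_compute. Qed.

Lemma size_unital_triples : size unital_triples = 252. Proof. by vm_compute. Qed.

Lemma exponentsP n d e : size e = n -> sumn e <= d -> e \in exponents n d.
Proof.
elim: n d e => [|n IHn] d [|k e] // [sz_e] le_d.
apply/allpairsPdep; exists k, e; rewrite mem_iota; move: le_d => /= le_d.
by split=> //; [lia | apply: IHn => //; lia].
Qed.

Lemma candidate e : size e = 5 -> sumn e <= 4 -> (e, sumn e, zpol e) \in candidates.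
Proof. by move=> se le4; apply/mapP; exists e => //; apply: exponentsP. Qed.

Lemma disjC : symmetric disj.
Proof. by elim=> [|a e IHe] [|b e'] //=; rewrite orbC IHe. Qed.

Lemma search_triple a b c : size a = 5 -> size b = 5 -> size c = 5 ->
    sumn a <= 4 -> sumn b <= 4 -> sumn c <= 4 ->
    disj a b -> disj a c -> disj b c -> two_max (sumn a) (sumn b) (sumn c) ->
  independent (zpol a) (zpol b) (zpol c) \/ (a, b, c) \in unital_triples.
Proof.
move=> sa sb sc la lb lc dab dac dbc t.
have ca := candidate sa la; have cb := candidate sb lb; have cc := candidate sc lc.
have := searchP; rewrite /search => /allP/(_ _ ca) /allP/(_ (b, sumn b, zpol b)).
rewrite mem_filter => /(_ (introT andP (conj dab cb))) /allP/(_ (c, sumn c, zpol c)).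
rewrite mem_filter => /(_ (introT andP (conj dac cc))).
rewrite [disj a _]dac [disj b _]dbc [two_max _ _ _]t [~~ true]/=.
by rewrite !orFb => /orP[]; [left|right].
Qed.

Local Open Scope classical_set_scope.
Local Open Scope card_scope.
Local Open Scope ring_scope.
Local Notation "p %:F" := (FracField.tofrac p) : ring_scope.

(** * Polynomials with roots in a finite set, and the Mason-Stothers bound *)

Section Polz.
Variable F : fieldType.
Implicit Types (s : seq F) (e : seq nat).

Definition polz s e : {poly F} := \prod_(sk <- zip s e) ('X - sk.1%:P) ^+ sk.2.

Lemma polz_cons z s k e : polz (z :: s) (k :: e) = ('X - z%:P) ^+ k * polz s e.
Proof. by rewrite /polz big_cons. Qed.

Lemma polz_nil e : polz [::] e = 1.
Proof. by rewrite /polz; case: e => *; rewrite big_nil. Qed.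

Lemma polz_nilr s : polz s [::] = 1.
Proof. by rewrite /polz; case: s => *; rewrite big_nil. Qed.

Lemma monic_polz s e : polz s e \is monic.
Proof. by apply: monic_prod => sk _; rewrite monic_exp ?monicXsubC. Qed.

Lemma polz_neq0 s e : polz s e != 0.
Proof. exact/monic_neq0/monic_polz. Qed.

Lemma root_polz s e z : root (polz s e) z -> z \in s.
Proof.
elim: s e => [|y s IHs] [|k e]; rewrite ?polz_nil ?polz_nilr ?(negPf (root1 _)) //.
rewrite polz_cons rootM inE => /orP[|/IHs ->]; last by rewrite orbT.
by case: k => [|k]; rewrite ?expr0 ?(negPf (root1 _)) // root_exp_XsubC => /eqP->; rewrite eqxx.
Qed.

Lemma size_polz s e : size s = size e -> size (polz s e) = (sumn e).+1.
Proof.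
elim: s e => [|z s IHs] [|k e] //; first by rewrite polz_nil size_poly1.
case=> /IHs sze; rewrite polz_cons size_monicM ?monic_exp ?monicXsubC ?polz_neq0 //.
by rewrite size_exp_XsubC sze addSn addnS.
Qed.

(** As the points are distinct, only the [j]-th factor vanishes at the [j]-th point. The exponents
    can thus be read back, whence [polz_inj]. *)
Lemma mup_polz s e j : uniq s -> size s = size e -> (j < size s)%N ->
  mup (nth 0 s j) (polz s e) = nth 0%N e j.
Proof.
elim: s e j => [|z s IHs] [|k e] //= j /andP[zNs us] [sz] lt_j.
rewrite polz_cons; case: j lt_j => [|j] /= lt_j.
  rewrite mupMl ?mup_XsubCX ?eqxx //.
  by apply: contra zNs => /root_polz.
rewrite mupMr ?IHs //; case: k => [|k]; first by rewrite expr0 root1.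
rewrite root_exp_XsubC; apply: contra zNs => /eqP <-; exact: mem_nth.
Qed.

Lemma polz_inj s e e' : uniq s -> size s = size e -> size s = size e' ->
  polz s e = polz s e' -> e = e'.
Proof.
move=> us se se' eq_pol; apply: (@eq_from_nth _ 0%N) => [|j]; first by rewrite -se.
by rewrite -se => lt_j; rewrite -(mup_polz us se lt_j) eq_pol mup_polz.
Qed.

Lemma coprime_polz s e e' : uniq s -> size s = size e -> size s = size e' ->
  coprimep (polz s e) (polz s e') = disj e e'.
Proof.
elim: s e e' => [|z s IHs] [|k e] [|k' e'] //= => [_ _ _|/andP[zNs us] [se] [se']].
  by rewrite polz_nil coprimep1.
(* Since [z] is not in [s], the head factor shares no root with a tail, and coprimality can be
   tested point by point. *)
have cz n e0 : coprimep (('X - z%:P) ^+ n) (polz s e0).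
  apply: coprimep_expl; rewrite coprimep_sym coprimep_XsubC.
  by apply: contra zNs => /root_polz.
rewrite !polz_cons coprimepMl !coprimepMr IHs // cz [coprimep (polz s e) _]coprimep_sym cz andbT /=.
congr andb; case: k => [|k]; first by rewrite expr0 coprime1p.
case: k' => [|k']; first by rewrite expr0 coprimep1.
by rewrite !exprS coprimepMl coprimepMr coprimep_XsubC root_XsubC eqxx.
Qed.

End Polz.

Lemma polz_factor (F : closedFieldType) (s : seq F) (p : {poly F}) : uniq s -> p != 0 ->
    (forall z, root p z -> z \in s) ->
  exists2 e, size s = size e & p = lead_coef p *: polz s e.
Proof.
move=> us p0 ps; have [rs def_p] := closed_field_poly_normal p.
have rs_s : {subset rs <= s}.
  by move=> z zrs; apply: ps; rewrite def_p rootZ ?lead_coef_eq0 // root_prod_XsubC.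
exists [seq count_mem z rs | z <- s]; first by rewrite size_map.
rewrite [LHS]def_p; congr (_ *: _).
rewrite -[X in polz X _]map_id /polz zip_map big_map /=.
(* The roots are grouped by value; the points of [s] that are not roots then contribute factors with
   exponent 0. *)
transitivity (\prod_(z <- s | z \in rs) ('X - z%:P) ^+ count_mem z rs).
  rewrite -prodr_undup_exp_count -[RHS]big_filter; apply: perm_big.
  apply: uniq_perm; rewrite ?undup_uniq ?filter_uniq // => z.
  by rewrite mem_undup mem_filter andb_idr //; apply: rs_s.
rewrite big_mkcond; apply: eq_bigr => z _; case: ifPn => // zNrs.
by rewrite (count_memPn zNrs) expr0.
Qed.

Section Stothers.
Variable F : numFieldType.
Implicit Types p q r t : {poly F}.

(** Characteristic zero enters here: a positive integer multiple of a coefficient vanishes only with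
    the coefficient. *)
Lemma deriv_eq0 p : (p^`() == 0) = (size p <= 1)%N.
Proof.
apply/eqP/idP => [dp0|/size1_polyC ->]; last exact: derivC.
apply/leq_sizeP => -[//|j] _; have /eqP := congr1 (fun p => p`_j) dp0.
by rewrite coef_deriv coef0 mulrn_eq0 /= => /eqP.
Qed.

(** A nonzero derivative is smaller than [p], hence not a multiple of it. *)
Lemma dvdp_deriv p : (p %| p^`()) = (size p <= 1)%N.
Proof.
rewrite -deriv_eq0; apply/idP/eqP => [dvd|->]; last exact: dvdp0.
apply/eqP; apply: contraTT isT => dp0; have := dvdp_leq dp0 dvd.
have p0 : p != 0 by apply: contraNneq dp0 => ->; rewrite deriv0.
by rewrite leqNgt lt_size_deriv.
Qed.

(** If the Wronskian vanished, coprimality would make [p] divide its derivative, and likewise [q],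
    so both would be constant. *)
Lemma wronskian_neq0 p q : coprimep p q -> (1 < maxn (size p) (size q))%N ->
  p^`() * q != p * q^`().
Proof.
move=> cpq; apply: contraTneq => eqW; rewrite -leqNgt geq_max -!dvdp_deriv.
rewrite -(Gauss_dvdpl _ cpq) eqW dvdp_mulr //.
by rewrite coprimep_sym in cpq; rewrite -(Gauss_dvdpr _ cpq) -eqW dvdp_mull.
Qed.

(** Differentiating a power of ['X - z] costs one factor, which the product over [s] restores; the
    product rule does the rest. *)
Lemma dvdp_deriv_prod_XsubC (s : seq F) e :
  polz s e %| (polz s e)^`() * \prod_(z <- s) ('X - z%:P).
Proof.
elim: s e => [|z s IHs] [|k e]; rewrite ?polz_nil ?polz_nilr ?dvd1p //.
rewrite polz_cons big_cons derivM mulrDl dvdp_add //.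
  rewrite mulrACA; apply: dvdp_mul; last exact: dvdp_mulr.
  rewrite deriv_exp derivXsubC mul1r; case: k => [|k]; first by rewrite dvd1p.
  by rewrite mulrnAl -exprSr -mulr_natr dvdp_mulr.
by rewrite mulrACA dvdp_mul // dvdp_mulr.
Qed.

Lemma coprimep_sum0 p q r : p + q + r = 0 -> coprimep p q -> coprimep p r.
Proof.
move=> pqr0; rewrite -(coprimep_addl_mul 1 q p) mul1r -[p + q]opprK (_ : - (p + q) = r).
  by rewrite -scaleN1r coprimepZr // oppr_eq0 oner_eq0.
by apply/esym/eqP; rewrite -addr_eq0 addrC pqr0.
Qed.

(** As [p], [q], [r] sum to zero, any two of them have the same Wronskian [W] up to sign, so each
    divides [W * t]; being pairwise coprime, so does their product. Since deg W < deg p + deg q,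
    comparing degrees leaves deg r < deg t. *)
Lemma stothers p q r t : p + q + r = 0 -> coprimep p q -> t != 0 ->
    (1 < maxn (size p) (size q))%N ->
    p %| p^`() * t -> q %| q^`() * t -> r %| r^`() * t ->
  (size r < size t)%N.
Proof.
move=> pqr0 cpq t0 big pt qt rt.
have W0 := wronskian_neq0 cpq big; rewrite -subr_eq0 in W0.
set W := _ - _ in W0.
have def_r : r = - (p + q) by apply/eqP; rewrite -addr_eq0 addrC pqr0.
have cpr := coprimep_sum0 pqr0 cpq.
have cqr : coprimep q r.
  by apply: (@coprimep_sum0 _ p); rewrite 1?coprimep_sym // [q + p]addrC.
have dvd : p * (q * r) %| W * t.
  rewrite !Gauss_dvdp ?coprimepMr ?cpq //; apply/and3P; split.
  - have -> : W * t = p^`() * t * q - p * (q^`() * t) by rewrite /W; ring.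
    by apply: dvdp_sub; [apply: dvdp_mulr | apply: dvdp_mulIl].
  - have -> : W * t = p^`() * t * q - p * (q^`() * t) by rewrite /W; ring.
    by apply: dvdp_sub; [apply: dvdp_mulIr | apply: dvdp_mull].
  - have -> : W * t = p * (r^`() * t) - r * (p^`() * t).
      by rewrite /W def_r derivN derivD; ring.
    by apply: dvdp_sub; [apply: dvdp_mull | apply: dvdp_mulIl].
have Wt0 : W * t != 0 by rewrite mulf_neq0.
have pqr : p * (q * r) != 0.
  by apply: contraNneq Wt0 => pqr; move: dvd; rewrite pqr dvd0p.
have [p0 q0 r0] : [/\ p != 0, q != 0 & r != 0].
  by move: pqr; rewrite !mulf_eq0 !negb_or => /and3P[].
have leW : (size W < size (p * q)%R)%N.
  have sz_mul (u v : {poly F}) : u != 0 -> v != 0 -> (size (u^`() * v)%R < size (u * v)%R)%N.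
    move=> u0 v0; apply: leq_ltn_trans (size_polyMleq _ _) _.
    rewrite size_mul //; have := lt_size_deriv u0; have : (0 < size v)%N by rewrite size_poly_gt0.
    by move: (size v) (size u) (size _) => a b c; clear; lia.
  rewrite /W; apply: leq_ltn_trans (size_polyD _ _) _; rewrite size_polyN gtn_max sz_mul //=.
  by rewrite [p * q]mulrC [p * _]mulrC sz_mul.
have := dvdp_leq Wt0 dvd; rewrite mulrA [size (W * t)]size_mul // size_mul ?mulf_neq0 //.
have : (0 < size W)%N by rewrite size_poly_gt0.
have : (0 < size r)%N by rewrite size_poly_gt0.
move: leW; move: (size W) (size r) (size (p * q)) (size t) => w n m k; clear; lia.
Qed.

End Stothers.

(** * Gaussian points *)

Section GaussianPoints.
Variables (F : numClosedFieldType) (i : F).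
Hypothesis i2 : i ^+ 2 = -1.

Definition pts : seq F := [:: 0; 1; -1; i; - i].
Definition pol (e : seq nat) : {poly F} := polz pts e.

Lemma i_neq0 : i != 0.
Proof. by apply/eqP => i0; move/eqP: i2; rewrite i0 expr0n eq_sym oppr_eq0 oner_eq0. Qed.

Lemma uniq_pts : uniq pts.
Proof.
have neq_opp (x : F) : x != 0 -> x != - x.
  by move=> x0; rewrite -subr_eq0 opprK -mulr2n mulrn_eq0.
have neq_i (x : F) : x ^+ 2 = 1 -> x != i.
  by move=> x2; apply: contraNneq (neq_opp _ (oner_neq0 F)) => xi; rewrite -x2 {1}xi i2 x2.
have sq1 : (-1) ^+ 2 = 1 :> F by rewrite sqrrN expr1n.
rewrite /= !inE !negb_or ![0 == _]eq_sym !oppr_eq0 oner_eq0 i_neq0 !neq_opp ?oner_neq0 ?i_neq0 //.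
rewrite !neq_i ?expr1n ?sq1 //= eqr_opp neq_i ?expr1n // andbT.
by rewrite -[1 == _]eqr_opp opprK neq_i.
Qed.

Lemma mem_pts z : (z \in pts) = (z == 0) || (z ^+ 4 == 1).
Proof.
have -> : (z ^+ 4 == 1) = ((z - 1) * (z + 1) * ((z - i) * (z + i)) == 0).
  by rewrite -subr_eq0; congr (_ == 0); rewrite -!subr_sqr i2; ring.
by rewrite !inE !mulf_eq0 !subr_eq0 !addr_eq0 !orbA.
Qed.

Lemma pts_unity z : z \in pts -> z = 0 \/ 4.-unity_root z.
Proof. by rewrite mem_pts unity_rootE => /orP[/eqP|]; [left|right]. Qed.

Lemma unity_pts z : z = 0 \/ 4.-unity_root z -> z \in pts.
Proof. by rewrite mem_pts unity_rootE => -[->|->]; rewrite ?eqxx ?orbT. Qed.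

Definition zi_val (x : zi) : F :=
  (int_of_Z x.1)%:~R + i * (int_of_Z x.2)%:~R.

Lemma zi_valD x y : zi_val (zi_add x y) = zi_val x + zi_val y.
Proof. by rewrite /zi_val /= !(rmorphD int_of_Z) !rmorphD /=; ring. Qed.

Lemma zi_valN x : zi_val (zi_opp x) = - zi_val x.
Proof. by rewrite /zi_val /= !(rmorphN int_of_Z) !rmorphN /=; ring. Qed.

Lemma zi_valM x y : zi_val (zi_mul x y) = zi_val x * zi_val y.
Proof.
rewrite /zi_val /= !(rmorphD int_of_Z) (rmorphN int_of_Z) !(rmorphM int_of_Z).
by rewrite !(rmorphD, rmorphN, rmorphM) /=; ring: i2.
Qed.

Lemma zi_val0 : zi_val zi0 = 0.
Proof. by rewrite /zi_val /= mulr0 addr0. Qed.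

(** Multiplying by the conjugate gives the norm, a sum of two integer squares that vanishes in
    characteristic zero only if both do. *)
Lemma zi_val_eq0 x : zi_val x = 0 -> zi_is0 x.
Proof.
case: x => a b; rewrite /zi_val /= => ab0.
have /eqP : (int_of_Z a ^+ 2 + int_of_Z b ^+ 2)%:~R = 0 :> F.
  transitivity (((int_of_Z a)%:~R + i * (int_of_Z b)%:~R) *
                ((int_of_Z a)%:~R - i * (int_of_Z b)%:~R)); last by rewrite ab0 mul0r.
  by rewrite rmorphD !rmorphXn /=; ring: i2.
rewrite intr_eq0 paddr_eq0 ?sqr_ge0 // !sqrf_eq0.
by rewrite !(inj_eq (can_inj int_of_ZK) _ Z0).
Qed.

Lemma zi_roots_val : map zi_val zi_roots = pts.
Proof. by rewrite /zi_roots /= /zi_val /= !mulr0 !mulr1 ?addr0 !add0r mulrN1. Qed.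

Lemma mulXsubP s c p : Poly (map zi_val (mulXsub s c p)) =
  (zi_val c)%:P + ('X - (zi_val s)%:P) * Poly (map zi_val p).
Proof.
elim: p c => [|a p IHp] c /=; first by rewrite !cons_poly_def mul0r add0r mulr0 addr0.
by rewrite !cons_poly_def IHp zi_valD zi_valN zi_valM polyCB polyCM; ring.
Qed.

Lemma zpolP e : Poly (map zi_val (zpol e)) = pol e.
Proof.
rewrite /zpol /pol -zi_roots_val; elim: zi_roots e => [|s ss IHs] [|k e];
  rewrite ?polz_nil ?polz_nilr /= ?polz_cons -?IHs;
  try by rewrite cons_poly_def mul0r add0r /zi_val /= mulr0 addr0.
elim: k => [|k IHk]; first by rewrite expr0 mul1r.
by rewrite iterS mulXsubP IHk zi_val0 add0r mulrA -exprS.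
Qed.

Lemma coef_pol e k : (pol e)`_k = zi_val (nth zi0 (zpol e) k).
Proof.
rewrite -zpolP coef_Poly; have [lt_k|ge_k] := ltnP k (size (zpol e)).
  by rewrite (nth_map zi0).
by rewrite !nth_default ?size_map // zi_val0.
Qed.

(** If the third coefficient row were a combination of the first two, every minor would vanish
    identically. *)
Lemma independentP u v w a b : independent (zpol u) (zpol v) (zpol w) ->
  a *: pol u + b *: pol v != pol w.
Proof.
case/hasP=> -[[j k] l] _ /=; apply: contraNneq => eq_w; apply: zi_val_eq0.
rewrite /minor !(zi_valD, zi_valN, zi_valM) -!coef_pol -eq_w !coefE; ring.
Qed.

End GaussianPoints.

(** * Rational functions with a prescribed triple *)

Lemma fraction_numden (D : idomainType) (x : {fraction D}) :
  exists n d : D, d != 0 /\ x = n%:F / d%:F.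
Proof.
elim/quotW: x => r; exists \n_r, \d_r; have d0 := denom_ratioP r; split=> //.
apply: (canRL (mulfK _)); first by rewrite tofrac_eq0.
unlock FracField.tofrac; rewrite -[LHS]FracField.pi_mul; apply/eqmodP.
by rewrite /= FracField.equivfE /FracField.mulf !numden_Ratio ?oner_neq0 ?mulr1 ?mul1r // mulrC.
Qed.

(* On the concrete field [{fraction {poly F}}], [field] and [done] get lost in
   unfolding fractions; hence the identities over an abstract field. *)
Section FieldIdentities.
Variable K : fieldType.
Implicit Types a b p q r v : K.

Lemma inv_ratio a p r : 1 / (a * p / r) = a^-1 * r / p.
Proof. by rewrite div1r !invfM invrK mulrAC. Qed.

Lemma one_sub_inv_ratio a b p q r v : a != 0 -> p != 0 -> r != 0 ->
  v = a * p / r -> 1 - v = b * q / r -> 1 - 1 / v = - (b / a) * q / p.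
Proof.
move=> a0 p0 r0 def_v eq_v; have v0 : v != 0 by rewrite def_v !mulf_neq0 ?invr_eq0.
have -> : 1 - 1 / v = - (1 - v) / v by field.
by rewrite eq_v def_v; field; rewrite a0 p0 r0.
Qed.

Lemma ratio_rescale a b p r : a != 0 -> b * p / r = b / a * (a * p / r).
Proof. by move=> a0; rewrite !mulrA divfK. Qed.

(** For comparing two functions with the same triple: [a] and [b] are the ratios of their constant
    factors. *)
Lemma affine_dependence a b v : 1 - a * v = b * (1 - v) -> (a - b) * v = 1 - b.
Proof.
move=> h; have -> : (a - b) * v = 1 - b - (1 - a * v - b * (1 - v)) by ring.
by rewrite h; ring.
Qed.

End FieldIdentities.

Section RationalFunctions.
Variable F : fieldType.
Implicit Types (U : {fraction {poly F}}) (p q r : {poly F}).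

Lemma fraction_coprime U : exists p q, [/\ q != 0, coprimep p q & U = p%:F / q%:F].
Proof.
have [p [q [q0 ->]]] := fraction_numden U.
have g0 : gcdp p q != 0 by rewrite gcdp_eq0 negb_and q0 orbT.
exists (p %/ gcdp p q), (q %/ gcdp p q); split.
- by rewrite dvdp_div_eq0 ?dvdp_gcdr.
- by rewrite coprimep_div_gcd // q0 orbT.
transitivity ((p %/ gcdp p q * gcdp p q)%:F / (q %/ gcdp p q * gcdp p q)%:F).
  by rewrite !divpK ?dvdp_gcdl ?dvdp_gcdr.
by rewrite !tofracM -mulf_div divff ?mulr1 // tofrac_eq0.
Qed.

Lemma ratconst_eq0 (c : F) : (ratconst c == 0) = (c == 0).
Proof. by rewrite tofrac_eq0 polyC_eq0. Qed.

(** Uniqueness of lowest terms: after cross-multiplication coprimality gives divisibility both ways,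
    and associated monic polynomials are equal. *)
Lemma frac_monic_inj (a a' : F) p r p' r' : a != 0 -> a' != 0 ->
    p \is monic -> r \is monic -> p' \is monic -> r' \is monic ->
    coprimep p r -> coprimep p' r' ->
  ratconst a * p%:F / r%:F = ratconst a' * p'%:F / r'%:F -> p = p' /\ r = r'.
Proof.
move=> a0 a'0 mp mr mp' mr' cpr cpr' /eqP.
rewrite eqr_div ?tofrac_eq0 ?monic_neq0 // -!tofracM tofrac_eq !mul_polyC -!scalerAl.
move=> /eqP eq_pr; have {}eq_pr : p * r' %= p' * r.
  by rewrite -(eqp_ltrans (eqp_scale _ a0)) eq_pr (eqp_ltrans (eqp_scale _ a'0)) eqpxx.
have monic_eqp (u v : {poly F}) : u \is monic -> v \is monic -> u %| v -> v %| u -> u = v.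
  by move=> mu mv uv vu; apply/eqP; rewrite -eqp_monic // /eqp uv.
split; apply: monic_eqp => //.
- by rewrite -(Gauss_dvdpl _ cpr) -(eqp_dvdr _ eq_pr) dvdp_mulr.
- by rewrite -(Gauss_dvdpl _ cpr') (eqp_dvdr _ eq_pr) dvdp_mulr.
- by rewrite coprimep_sym in cpr; rewrite -(Gauss_dvdpr _ cpr) (eqp_dvdr _ eq_pr) dvdp_mull.
- by rewrite coprimep_sym in cpr'; rewrite -(Gauss_dvdpr _ cpr') -(eqp_dvdr _ eq_pr) dvdp_mull.
Qed.

End RationalFunctions.

Section Divisors.
Variables (F : numClosedFieldType) (i : F).
Hypothesis i2 : i ^+ 2 = -1.
Implicit Types U V f : {fraction {poly F}}.
Local Notation pol := (pol i).

(** [V] and [1 - V] have the same poles, hence one denominator. The constants stay free, as zeros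
    and poles do not show them. *)
Definition has_divisor V (t : triple) := exists a b : F,
  [/\ a != 0, b != 0, V = ratconst a * (pol t.1.1)%:F / (pol t.2)%:F
    & 1 - V = ratconst b * (pol t.1.2)%:F / (pol t.2)%:F].

(** Disjoint supports put both fractions in lowest terms; the positive total degree excludes
    constants. *)
Definition admissible (t : triple) : bool :=
  [&& size t.1.1 == 5%N, size t.1.2 == 5%N, size t.2 == 5%N,
      [&& disj t.1.1 t.1.2, disj t.1.1 t.2 & disj t.1.2 t.2]
    & (0 < sumn t.1.1 + sumn t.1.2 + sumn t.2)%N].

Lemma ratfun_pol_neq0 e : (pol e)%:F != 0.
Proof. by rewrite tofrac_eq0 polz_neq0. Qed.

Lemma ratfun_neq0 (a : F) e e' : a != 0 -> ratconst a * (pol e)%:F / (pol e')%:F != 0.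
Proof.
move=> a0; apply: mulf_neq0; first apply: mulf_neq0.
- by rewrite ratconst_eq0.
- exact: ratfun_pol_neq0.
- by rewrite invr_eq0; apply: ratfun_pol_neq0.
Qed.

Lemma has_divisor_subr V a b c :
  has_divisor V (a, b, c) -> has_divisor (1 - V) (b, a, c).
Proof. by case=> A [B [? ? ? ?]]; exists B, A; split; rewrite // subKr. Qed.

Lemma has_divisor_inv V a b c :
  has_divisor V (a, b, c) -> has_divisor (1 / V) (c, b, a).
Proof.
case=> A [B [A0 B0 /= VA VB]].
have rA0 : ratconst A != 0 by rewrite ratconst_eq0.
have iA : ratconst A^-1 = (ratconst A)^-1.
  by apply: (mulIf rA0); rewrite mulVf // /ratconst -tofracM -polyCM mulVf // polyC1 tofrac1.
have rAB : ratconst (- (B / A)) = - (ratconst B / ratconst A).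
  by rewrite -iA /ratconst polyCN polyCM tofracN tofracM.
(* The second constant comes from [1 - 1 / V = - (1 - V) / V]. *)
exists A^-1, (- (B / A)); rewrite rAB iA; split.
- by rewrite invr_eq0.
- by rewrite oppr_eq0 mulf_neq0 ?invr_eq0.
- by rewrite VA inv_ratio.
- exact: one_sub_inv_ratio rA0 (ratfun_pol_neq0 _) (ratfun_pol_neq0 _) VA VB.
Qed.

Lemma coprime_pol e e' : size e = 5%N -> size e' = 5%N ->
  coprimep (pol e) (pol e') = disj e e'.
Proof. by move=> se se'; rewrite coprime_polz ?se ?se' ?uniq_pts. Qed.

(** A constant has lowest terms with numerator and denominator 1. Uniqueness, applied to [V] and to
    [1 - V], would make all three exponent vectors zero. *)
Lemma has_divisor_nonconstant V t : admissible t -> has_divisor V t -> ~ is_constant V.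
Proof.
case: t => [[e0 e1] e2] /and5P[/= /eqP s0 /eqP s1 /eqP s2 /and3P[_ d02 d12] pos].
case=> a [b [/= a0 b0 Va Vb]] [c Vc].
have const_frac (x y : F) e : x != 0 -> size e = 5%N -> disj e e2 ->
    ratconst y = ratconst x * (pol e)%:F / (pol e2)%:F -> sumn e = 0%N /\ sumn e2 = 0%N.
  move=> x0 se de eq_xy; have y0 : y != 0.
    by rewrite -ratconst_eq0 eq_xy ratfun_neq0.
  have eq1 : ratconst x * (pol e)%:F / (pol e2)%:F = ratconst y * 1%:F / 1%:F.
    by rewrite -eq_xy tofrac1 mulr1 divr1.
  have [||||||||e1' e21] := frac_monic_inj _ _ _ _ _ _ _ _ eq1;
    rewrite ?monic_polz ?monic1 ?coprime_pol ?coprimep1 //.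
  have sz e' : size e' = 5%N -> pol e' = 1 -> sumn e' = 0%N.
    by move=> se' p1; apply: succn_inj; rewrite -(@size_polz _ (pts i)) // -/(pol _) p1 size_poly1.
  by rewrite !sz.
have [] := const_frac a c e0 a0 s0 d02; first by rewrite -Vc.
have [] := const_frac b (1 - c) e1 b0 s1 d12.
  by rewrite -Vb Vc /ratconst polyCB tofracB polyC1 tofrac1.
by move=> z1 z2 z0; rewrite z0 z1 z2 in pos.
Qed.

Lemma has_divisor_fun V V' t : admissible t -> has_divisor V t -> has_divisor V' t -> V = V'.
Proof.
move=> adm Vt; have ncV := has_divisor_nonconstant adm Vt.
case: Vt => a [b [a0 b0 Va Vb]] [a' [b' [a'0 b'0 V'a V'b]]].
have ra0 : ratconst a != 0 by rewrite ratconst_eq0.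
have rb0 : ratconst b != 0 by rewrite ratconst_eq0.
have rdiv (x y : F) : y != 0 -> ratconst x / ratconst y = ratconst (x / y).
  move=> y0; apply: (canLR (mulfK _)); first by rewrite ratconst_eq0.
  by rewrite /ratconst -tofracM -polyCM divfK.
have rB (u v : F) : ratconst u - ratconst v = ratconst (u - v).
  by rewrite /ratconst polyCB tofracB.
have r1 : 1 = ratconst (1 : F) by rewrite /ratconst polyC1 tofrac1.
have defa : V' = ratconst (a' / a) * V.
  by rewrite -(rdiv _ _ a0) V'a Va; exact: ratio_rescale ra0.
have defb : 1 - V' = ratconst (b' / b) * (1 - V).
  by rewrite -(rdiv _ _ b0) V'b Vb; exact: ratio_rescale rb0.
move: (a' / a) (b' / b) defa defb => x y defa defb.
have eqxy : (ratconst x - ratconst y) * V = 1 - ratconst y.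
  by apply: affine_dependence; rewrite -defa.
(* If [x = y], the affine equation reads [0 = 1 - y], so both ratios are 1; otherwise it makes [V]
   constant. *)
have [exy|] := eqVneq x y.
  rewrite defa exy; move: eqxy; rewrite exy subrr mul0r => /esym/eqP.
  by rewrite subr_eq0 => /eqP<-; rewrite mul1r.
rewrite -subr_eq0 => nxy; case: ncV; exists ((1 - y) / (x - y)).
have nxyF : ratconst x - ratconst y != 0 by rewrite rB ratconst_eq0.
by rewrite -(rdiv _ _ nxy) -!rB -r1 -eqxy mulrC (mulKf nxyF).
Qed.

Lemma has_divisor_inj V t t' : admissible t -> admissible t' ->
  has_divisor V t -> has_divisor V t' -> t = t'.
Proof.
case: t t' => [[e0 e1] e2] [[e0' e1'] e2'].
move=> /and5P[/= /eqP s0 /eqP s1 /eqP s2 /and3P[_ d02 d12] _].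
move=> /and5P[/= /eqP s0' /eqP s1' /eqP s2' /and3P[_ d02' d12'] _].
move=> [a [b [/= a0 b0 Va Vb]]] [a' [b' [/= a'0 b'0 Va' Vb']]].
have inj e e' : size e = 5%N -> size e' = 5%N -> pol e = pol e' -> e = e'.
  by move=> se se'; apply: polz_inj; rewrite ?se ?se' ?uniq_pts.
rewrite Va' in Va; rewrite Vb' in Vb.
have [||||||||? ?] := frac_monic_inj _ _ _ _ _ _ _ _ Va; rewrite ?monic_polz ?coprime_pol //.
have [||||||||? _] := frac_monic_inj _ _ _ _ _ _ _ _ Vb; rewrite ?monic_polz ?coprime_pol //.
by congr (_, _, _); apply: inj.
Qed.

End Divisors.

(** * Passing between 4-unital functions and triples *)

Section Unital.
Variables (F : numClosedFieldType) (i : F).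
Hypothesis i2 : i ^+ 2 = -1.
Implicit Types U V f : {fraction {poly F}}.
Local Notation pol := (pol i).
Local Notation has_divisor := (has_divisor i).

Lemma ratconst_frac_eq a e e' p q : q != 0 ->
    p%:F / q%:F = ratconst a * (pol e)%:F / (pol e')%:F ->
  p * pol e' = a *: pol e * q.
Proof.
move=> q0 /eqP; rewrite eqr_div ?ratfun_pol_neq0 ?tofrac_eq0 // -!tofracM tofrac_eq.
by rewrite mul_polyC => /eqP.
Qed.

(** The fraction [p / q] witnessing a zero or a pole is arbitrary; cross-multiplying with the given
    one moves the root into [pol e] or [pol e']. *)
Lemma pol_zeros U a e e' z : a != 0 -> U = ratconst a * (pol e)%:F / (pol e')%:F ->
  is_zero U z \/ is_pole U z -> z \in pts i.
Proof.
move=> a0 -> [[p [q [eqU pz qz]]]|[p [q [q0 eqU pz qz]]]].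
  have q0 : q != 0 by apply: contraNneq qz => ->; rewrite root0.
  have eqpq := ratconst_frac_eq q0 (esym eqU).
  have : root (a *: pol e * q) z by rewrite -eqpq rootM pz.
  by rewrite rootM (negPf qz) orbF rootZ // => /root_polz.
have eqpq := ratconst_frac_eq q0 (esym eqU).
have : root (p * pol e') z by rewrite eqpq rootM qz orbT.
by rewrite rootM (negPf pz) /= => /root_polz.
Qed.

Lemma has_divisor_unital V t : admissible t -> has_divisor V t -> unital 4 V.
Proof.
move=> adm Vt; split; first exact: has_divisor_nonconstant Vt.
case: Vt => a [b [a0 b0 Va Vb]] z zV; apply: (pts_unity i2).
have [] : (is_zero V z \/ is_pole V z) \/ (is_zero (1 - V) z \/ is_pole (1 - V) z).
- by tauto.
- exact: pol_zeros a0 Va.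
- exact: pol_zeros b0 Vb.
Qed.

Lemma pol_mason e e' e'' a b c :
    size e = 5%N -> size e' = 5%N -> size e'' = 5%N -> disj e e' ->
    (0 < sumn e + sumn e')%N -> a != 0 -> b != 0 -> c != 0 ->
    a *: pol e + b *: pol e' + c *: pol e'' = 0 ->
  (sumn e'' <= 4)%N.
Proof.
move=> se se' se'' dee' pos a0 b0 c0 sum0.
have dvd (x : F) d : x != 0 ->
    x *: pol d %| (x *: pol d)^`() * \prod_(z <- pts i) ('X - z%:P).
  by move=> x0; rewrite derivZ -scalerAl dvdpZl // dvdpZr // dvdp_deriv_prod_XsubC.
have size_pol d (x : F) : x != 0 -> size d = 5%N -> size (x *: pol d) = (sumn d).+1.
  by move=> x0 sd; rewrite size_scale // size_polz ?sd.
have := stothers sum0 _ _ _ (dvd _ _ a0) (dvd _ _ b0) (dvd _ _ c0).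
rewrite !size_pol // coprimepZl // coprimepZr // coprime_pol // dee'.
(* The product over the five points has size 6, one more than its degree, whence the bound 4. *)
rewrite monic_neq0 ?monic_prod_XsubC // size_prod_XsubC /= !ltnS => -> //.
by move: pos; move: (sumn e) (sumn e'); clear; lia.
Qed.

Lemma unital_has_divisor V : unital 4 V ->
  exists2 t, t \in unital_triples & has_divisor V t.
Proof.
case=> ncV zV; have [p [q [q0 cpq eqV]]] := fraction_coprime V.
have qF0 : q%:F != 0 by rewrite tofrac_eq0.
have eq1V : 1 - V = (q - p)%:F / q%:F by rewrite eqV tofracB mulrBl (divff qF0).
(* Modulo [q], the polynomial [q - p] is [- p]. *)
have cpqp : coprimep (q - p) q.
  rewrite coprimep_sym -(coprimep_addl_mul (-1) (q - p)) mulN1r addKr.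
  by rewrite -scaleN1r coprimepZr ?oppr_eq0 ?oner_eq0 // coprimep_sym.
have rootsN (u v : {poly F}) z : coprimep u v -> root v z -> ~~ root u z.
  by move=> cuv vz; apply/negP => uz; have := coprimep_root cuv uz; rewrite (rootP vz) eqxx.
have p0 : p != 0.
  by apply/eqP => p0; case: ncV; exists 0; rewrite eqV p0 /ratconst polyC0 tofrac0 mul0r.
have qp0 : q - p != 0.
  apply/eqP => qp0; case: ncV; exists 1; rewrite -[LHS](subKr 1) eq1V qp0.
  by rewrite tofrac0 mul0r subr0 /ratconst polyC1 tofrac1.
have p_pts z : root p z -> z \in pts i.
  move=> pz; apply: (unity_pts i2); apply: zV; left; exists p, q; split=> //.
  by apply: rootsN pz; rewrite coprimep_sym.
have q_pts z : root q z -> z \in pts i.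
  move=> qz; apply: (unity_pts i2); apply: zV; right; left; exists p, q; split=> //.
  exact: rootsN qz.
have qp_pts z : root (q - p) z -> z \in pts i.
  move=> qpz; apply: (unity_pts i2); apply: zV; right; right; left.
  by exists (q - p), q; split=> //; apply: rootsN qpz; rewrite coprimep_sym.
have [e0 /esym s0 def_p] := polz_factor (uniq_pts i2) p0 p_pts.
have [e1 /esym s1 def_qp] := polz_factor (uniq_pts i2) qp0 qp_pts.
have [e2 /esym s2 def_q] := polz_factor (uniq_pts i2) q0 q_pts.
have a0 : lead_coef p != 0 by rewrite lead_coef_eq0.
have b0 : lead_coef (q - p) != 0 by rewrite lead_coef_eq0.
have c0 : lead_coef q != 0 by rewrite lead_coef_eq0.
rewrite -/(pol e0) in def_p; rewrite -/(pol e1) in def_qp; rewrite -/(pol e2) in def_q.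
move: (lead_coef p) (lead_coef (q - p)) (lead_coef q) a0 b0 c0 def_p def_qp def_q.
move=> a b c a0 b0 c0 def_p def_qp def_q.
have d02 : disj e0 e2.
  by move: cpq; rewrite def_p def_q coprimepZl // coprimepZr // coprime_pol.
have d12 : disj e1 e2.
  by move: cpqp; rewrite def_qp def_q coprimepZl // coprimepZr // coprime_pol.
have d01 : disj e0 e1.
  rewrite -(coprime_pol i2) // -(coprimepZl _ _ a0) -(coprimepZr _ _ b0) -def_p -def_qp.
  by rewrite -(coprimep_addl_mul 1) mul1r addrC subrK.
have rel : a *: pol e0 + b *: pol e1 = c *: pol e2.
  by rewrite -def_p -def_qp -def_q addrC subrK.
have sz e : size e = 5%N -> size (pol e) = (sumn e).+1.
  by move=> se; rewrite size_polz ?se.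
have le_size (x y z : F) e e' e'' : size e = 5%N -> size e' = 5%N -> size e'' = 5%N ->
    z != 0 -> z *: pol e'' = x *: pol e + y *: pol e' ->
    (sumn e'' <= maxn (sumn e) (sumn e'))%N.
  move=> se se' se'' z0 eq_z; rewrite -ltnS -maxnSS -!sz // -(size_scale _ z0) eq_z.
  apply: leq_trans (size_polyD _ _) _.
  by rewrite geq_max !leq_max !size_scale_leq orbT.
have l2 : (sumn e2 <= maxn (sumn e0) (sumn e1))%N by apply: (le_size a b c); rewrite ?rel.
have l1 : (sumn e1 <= maxn (sumn e0) (sumn e2))%N.
  by apply: (le_size (- a) c b) => //; rewrite -rel scaleNr addKr.
have l0 : (sumn e0 <= maxn (sumn e1) (sumn e2))%N.
  by apply: (le_size (- b) c a) => //; rewrite -rel scaleNr [in RHS]addrC addrK.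
(* If the first two degrees vanish, so does the third by [l2], and [V] is the constant [a / c]. *)
have pos : maxn (sumn e0) (sumn e1) != 0%N.
  apply/eqP => m0; have [z0 z2] : sumn e0 = 0%N /\ sumn e2 = 0%N.
    by move: m0 l2; move: (sumn e0) (sumn e1) (sumn e2); clear; lia.
  have pol1 e : size e = 5%N -> sumn e = 0%N -> pol e = 1.
    move=> se ze; apply/eqP; rewrite -eqp_monic ?monic_polz ?monic1 //.
    by rewrite -size_poly_eq1 sz // ze.
  case: ncV; exists (a / c); rewrite eqV def_p def_q !pol1 // !alg_polyC /ratconst.
  apply: (canLR (mulfK _)); first by rewrite tofrac_eq0 polyC_eq0.
  by rewrite -tofracM -polyCM divfK.
have pos' : (0 < sumn e0 + sumn e1)%N.
  by move: pos; move: (sumn e0) (sumn e1); clear; lia.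
have sum0 : a *: pol e0 + b *: pol e1 + (- c) *: pol e2 = 0.
  by rewrite rel scaleNr subrr.
have cN0 : - c != 0 by rewrite oppr_eq0.
(* The three bounds come from the cyclic rotations of [sum0]; each needs the other two polynomials
   not both constant. *)
have m2 : (sumn e2 <= 4)%N by apply: pol_mason a0 b0 cN0 sum0.
have m1 : (sumn e1 <= 4)%N.
  have pos1 : (0 < sumn e2 + sumn e0)%N.
    by move: pos' l1; move: (sumn e0) (sumn e1) (sumn e2); clear; lia.
  apply: (pol_mason s2 s0 s1 _ pos1 cN0 a0 b0); first by rewrite disjC.
  by rewrite -addrA addrC.
have m0 : (sumn e0 <= 4)%N.
  have pos1 : (0 < sumn e1 + sumn e2)%N.
    by move: pos' l0; move: (sumn e0) (sumn e1) (sumn e2); clear; lia.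
  apply: (pol_mason s1 s2 s0 d12 pos1 b0 cN0 a0).
  by rewrite addrC addrA.
have tm : two_max (sumn e0) (sumn e1) (sumn e2) by apply/and4P.
have [indep|t_in] := search_triple s0 s1 s2 m0 m1 m2 d01 d02 d12 tm.
  (* Dividing the relation by [c] gives the combination that independence excludes. *)
  case/eqP: (independentP i2 (a / c) (b / c) indep).
  by rewrite ![_ / c]mulrC -!scalerA -scalerDr rel scalerA mulVf // scale1r.
exists (e0, e1, e2) => //.
have divc (x : F) (u v : {poly F}) : (x *: u)%:F / (c *: v)%:F = ratconst (x / c) * u%:F / v%:F.
  have -> : x *: u = (c * (x / c)) *: u by rewrite mulrCA divff // mulr1.
  have cF0 : (c%:P)%:F != 0 by rewrite tofrac_eq0 polyC_eq0.
  by rewrite -scalerA -!mul_polyC !tofracM -mulf_div (divff cF0) mul1r.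
exists (a / c), (b / c); split.
- by rewrite mulf_neq0 ?invr_eq0.
- by rewrite mulf_neq0 ?invr_eq0.
- by rewrite -divc -def_p -def_q.
- by rewrite -divc -def_qp -def_q.
Qed.

End Unital.

(** * The functions of the list *)

Section Monomials.
Variables (K : fieldType) (x I : K).
Hypothesis I2 : I ^+ 2 = -1.

Definition gauss (c : int * int) : K := c.1%:~R + c.2%:~R * I.

(** The image of [pol i e] in the fraction field ([tofrac_pol]), spelled out over an abstract field
    where [field] can work. *)
Definition monomial (e : seq nat) : K :=
  x ^+ nth 0%N e 0 * (x - 1) ^+ nth 0%N e 1 * (x + 1) ^+ nth 0%N e 2
  * (x - I) ^+ nth 0%N e 3 * (x + I) ^+ nth 0%N e 4.

(* [(f, (u, v), (u', v'))]: u + v I and u' + v' I are the constant factors of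
   [f] and of [1 - f]. *)
Definition orbit_row : Type := (K * (int * int) * (int * int))%type.

Definition row_divisor (r : orbit_row) (t : triple) : Prop :=
  [/\ r.1.2 != (0, 0), r.2 != (0, 0),
      r.1.1 = gauss r.1.2 * monomial t.1.1 / monomial t.2
    & 1 - r.1.1 = gauss r.2 * monomial t.1.2 / monomial t.2].

Fixpoint rows_divisors (rs : seq orbit_row) (ts : seq triple) : Prop :=
  match rs, ts with
  | r :: rs', t :: ts' => row_divisor r t /\ rows_divisors rs' ts'
  | [::], [::] => True
  | _, _ => False
  end.

Hypothesis x_generic : [&& x != 0, x - 1 != 0, x + 1 != 0, x - I != 0 & x + I != 0].

Let x0 : x != 0. Proof. by case/and5P: x_generic. Qed.
Let x1 : x - 1 != 0. Proof. by case/and5P: x_generic. Qed.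
Let x1' : x + 1 != 0. Proof. by case/and5P: x_generic. Qed.
Let xI : x - I != 0. Proof. by case/and5P: x_generic. Qed.
Let xI' : x + I != 0. Proof. by case/and5P: x_generic. Qed.

(** This and the next facts treat the denominators as they are written in the rows: each is a unit
    times a product of the generic factors. They discharge the side conditions of [field]. *)
Let x2p1 : x ^+ 2 + 1 != 0.
Proof. by have -> : x ^+ 2 + 1 = (x - I) * (x + I) by [ring: I2]; rewrite mulf_neq0. Qed.

Let x2m1 : x ^+ 2 - 1 != 0.
Proof. by rewrite subr_sqr_1 mulf_neq0. Qed.

Let I0 : I != 0.
Proof. by apply/eqP => i0; move/eqP: I2; rewrite i0 expr0n eq_sym oppr_eq0 oner_eq0. Qed.

Let x1N : -1 * x - 1 != 0.
Proof. by have -> : -1 * x - 1 = - (x + 1) by [ring]; rewrite oppr_eq0. Qed.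

Let Ix1 : I * x - 1 != 0.
Proof. by have -> : I * x - 1 = I * (x + I) by [ring: I2]; rewrite mulf_neq0. Qed.

Let Ix1N : - I * x - 1 != 0.
Proof. by have -> : - I * x - 1 = - I * (x - I) by [ring: I2]; rewrite mulf_neq0 ?oppr_eq0. Qed.

Let xNI : -1 * x + I != 0.
Proof. by have -> : -1 * x + I = - (x - I) by [ring]; rewrite oppr_eq0. Qed.

Let IxI : I * x + I != 0.
Proof. by have -> : I * x + I = I * (x + 1) by [ring]; rewrite mulf_neq0. Qed.

Let IxIN : - I * x + I != 0.
Proof. by have -> : - I * x + I = - I * (x - 1) by [ring]; rewrite mulf_neq0 ?oppr_eq0. Qed.

(** The functions keep the literal form and order of the defining unions with [e] substituted,
    factors 1 included, so that the two match by conversion. *)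
Definition rows_x : seq orbit_row :=
  [:: (1 * x, (1, 0), (-1, 0));
      (I * (1 * x + 1) / (1 * x - 1), (0, 1), (1, -1));
      ((1 * x + 1) / (1 * x + I), (1, 0), (-1, 1));
      (-1 * x, (-1, 0), (1, 0));
      (I * (-1 * x + 1) / (-1 * x - 1), (0, 1), (1, -1));
      ((-1 * x + 1) / (-1 * x + I), (1, 0), (1, -1));
      (I * x, (0, 1), (0, -1));
      (I * (I * x + 1) / (I * x - 1), (0, 1), (1, -1));
      ((I * x + 1) / (I * x + I), (1, 0), (1, 1));
      (- I * x, (0, -1), (0, 1));
      (I * (- I * x + 1) / (- I * x - 1), (0, 1), (1, -1));
      ((- I * x + 1) / (- I * x + I), (1, 0), (-1, -1))].

Definition rows_x2 : seq orbit_row :=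
  [:: (1 * x ^+ 2, (1, 0), (-1, 0));
      (1 * ((x - 1) / (x + 1)) ^+ 2, (1, 0), (4, 0));
      (1 * ((x - I) / (x + I)) ^+ 2, (1, 0), (0, 4));
      (-1 * x ^+ 2, (-1, 0), (1, 0));
      (-1 * ((x - 1) / (x + 1)) ^+ 2, (-1, 0), (2, 0));
      (-1 * ((x - I) / (x + I)) ^+ 2, (-1, 0), (2, 0))].

Definition rows_x4 : seq orbit_row :=
  [:: (x ^+ 4, (1, 0), (-1, 0));
      (((x + 1) / (x - 1)) ^+ 4, (1, 0), (-8, 0));
      (((x - I) / (x + I)) ^+ 4, (1, 0), (0, 8))].

Definition rows_2x_x2p1 : seq orbit_row :=
  [:: (2 * 1 * x / (x ^+ 2 + 1), (2, 0), (1, 0));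
      (2 * 1 * I * x / (x ^+ 2 - 1), (0, 2), (1, 0));
      (1 * (x ^+ 2 - 1) / (x ^+ 2 + 1), (1, 0), (2, 0));
      (2 * -1 * x / (x ^+ 2 + 1), (-2, 0), (1, 0));
      (2 * -1 * I * x / (x ^+ 2 - 1), (0, -2), (1, 0));
      (-1 * (x ^+ 2 - 1) / (x ^+ 2 + 1), (-1, 0), (2, 0))].

Definition rows_4x2 : seq orbit_row :=
  [:: (4 * x ^+ 2 / (x ^+ 2 + 1) ^+ 2, (4, 0), (1, 0))].

Definition rows_2x_xp1 : seq orbit_row :=
  [:: (1 * (x - 1) / (x + 1), (1, 0), (2, 0));
      (1 * (x - I) / (x + I), (1, 0), (0, 2));
      ((1 - I) * x / (x + 1), (1, -1), (0, 1));
      ((1 + I) * x / (x + 1), (1, 1), (0, -1));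
      (-1 * (x - 1) / (x + 1), (-1, 0), (2, 0));
      (-1 * (x - I) / (x + I), (-1, 0), (2, 0));
      ((1 - I) * x / (x + -1), (1, -1), (0, 1));
      ((1 + I) * x / (x + -1), (1, 1), (0, -1))].

Definition rows_xxm1_x2p1 : seq orbit_row :=
  [:: (x * (x - 1) / (x ^+ 2 + 1), (1, 0), (1, 0));
      (x * (x + 1) / (x ^+ 2 + 1), (1, 0), (-1, 0));
      (x * (x - I) / (x ^+ 2 - 1), (1, 0), (0, 1));
      (x * (x + I) / (x ^+ 2 - 1), (1, 0), (0, -1))].

Definition rows_2x_xp1xpi : seq orbit_row :=
  [:: (2 * (1 + I) * x / ((x + 1) * (x + I)), (2, 2), (1, 0));
      (2 * (1 - I) * x / ((x + 1) * (x - I)), (2, -2), (1, 0))].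

Definition rows : seq orbit_row :=
  rows_x ++ rows_x2 ++ rows_x4 ++ rows_2x_x2p1 ++ rows_4x2 ++ rows_2x_xp1
  ++ rows_xxm1_x2p1 ++ rows_2x_xp1xpi.

Lemma rowsP : rows_divisors rows base_triples.
Proof.
repeat split; rewrite //= /gauss /monomial /= ?expr0 ?expr1 ?mul1r ?mulr1;
  field: I2;
  by rewrite ?x0 ?x1 ?x1' ?xI ?xI' ?x2p1 ?x2m1 ?x1N ?Ix1 ?Ix1N ?xNI ?IxI ?IxIN ?oner_eq0.
Qed.

End Monomials.

(** * The six-element orbits, the solution sets of triples and the count *)

Section OrbitIdentities.
Variable K : fieldType.
Implicit Type f : K.

(** The last three members of [orbit6] are composites of [1 - f] and [1 / f], whose effect on
    triples is known. *)
Lemma orbit_div_sub1 f : 1 - f != 0 -> f / (f - 1) = 1 - 1 / (1 - f).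
Proof.
move=> f1; have f1' : f - 1 != 0 by rewrite -opprB oppr_eq0.
by field; rewrite f1 f1'.
Qed.

Lemma orbit_sub1_div f : f != 0 -> (f - 1) / f = 1 - 1 / f.
Proof. by move=> f0; field. Qed.

Lemma orbit_inv_sub1 f : - 1 / (f - 1) = 1 / (1 - f).
Proof. by rewrite -[f - 1]opprB invrN mulrNN. Qed.

End OrbitIdentities.

Lemma admissible_S3_orbit t t' : admissible t -> t' \in S3_orbit t -> admissible t'.
Proof.
case: t => [[a b] c] /and5P[/= sa sb sc /and3P[ab ac bc] pos].
have pos2 : (0 < sumn b + sumn a + sumn c)%N by rewrite [(sumn b + _)%N]addnC.
have pos3 : (0 < sumn c + sumn b + sumn a)%N by rewrite -addnA addnC.
have pos4 : (0 < sumn a + sumn c + sumn b)%N by rewrite addnAC.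
have pos5 : (0 < sumn b + sumn c + sumn a)%N by rewrite addnC addnA.
have pos6 : (0 < sumn c + sumn a + sumn b)%N by rewrite addnAC -addnA addnC.
have [ba ca cb] : [/\ disj b a, disj c a & disj c b] by rewrite disjC (disjC c a) (disjC c b).
by rewrite !inE => /or4P[|||/or3P[]] /eqP->; apply/and5P; split=> //=; apply/and3P.
Qed.

Section Solutions.
Variables (F : numClosedFieldType) (i : F).
Hypothesis i2 : i ^+ 2 = -1.
Implicit Types U V f : {fraction {poly F}}.
Local Notation has_divisor := (has_divisor i).
Local Notation x := (ratX F).
Local Notation I := (ratconst i).

Lemma ratconst_i2 : I ^+ 2 = -1.
Proof. by rewrite /ratconst -tofracXn -polyC_exp i2 polyCN polyC1 tofracN tofrac1. Qed.

Lemma ratX_sub_neq0 c : x - ratconst c != 0.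
Proof. by rewrite -tofracB tofrac_eq0 polyXsubC_eq0. Qed.

Lemma ratX_generic : [&& x != 0, x - 1 != 0, x + 1 != 0, x - I != 0 & x + I != 0].
Proof.
have x0 : x != 0 by rewrite tofrac_eq0 polyX_eq0.
have x1 : x - 1 != 0 by have := ratX_sub_neq0 1; rewrite /ratconst polyC1 tofrac1.
have x1' : x + 1 != 0.
  by have := ratX_sub_neq0 (-1); rewrite /ratconst polyCN polyC1 tofracN tofrac1 opprK.
have xI' : x + I != 0.
  by have := ratX_sub_neq0 (- i); rewrite /ratconst polyCN tofracN opprK.
exact: (introT and5P (And5 x0 x1 x1' (ratX_sub_neq0 i) xI')).
Qed.

Definition solutions (ts : seq triple) : set {fraction {poly F}} :=
  [set V | exists2 t, t \in flatten (map S3_orbit ts) & has_divisor V t].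

Lemma has_divisor_neq0 V t : has_divisor V t -> V != 0 /\ 1 - V != 0.
Proof. by case=> a [b [a0 b0 -> ->]]; split; apply: ratfun_neq0. Qed.

Section Orbit.
Variables (f : {fraction {poly F}}) (a b c : seq nat).
Hypothesis f_abc : has_divisor f (a, b, c).

Let f0 : f != 0 := proj1 (has_divisor_neq0 f_abc).
Let f1 : 1 - f != 0 := proj2 (has_divisor_neq0 f_abc).

Let f_bac : has_divisor (1 - f) (b, a, c).
Proof. exact: has_divisor_subr. Qed.
Let f_cba : has_divisor (1 / f) (c, b, a).
Proof. exact: has_divisor_inv. Qed.
Let f_cab : has_divisor (- 1 / (f - 1)) (c, a, b).
Proof. by rewrite orbit_inv_sub1; apply: has_divisor_inv. Qed.
Let f_acb : has_divisor (f / (f - 1)) (a, c, b).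
Proof.
by rewrite (orbit_div_sub1 f1) -orbit_inv_sub1; apply: has_divisor_subr.
Qed.
Let f_bca : has_divisor ((f - 1) / f) (b, c, a).
Proof. by rewrite (orbit_sub1_div f0); apply: has_divisor_subr. Qed.

Lemma orbit6_divisor V : orbit6 f V ->
  exists2 t, t \in S3_orbit (a, b, c) & has_divisor V t.
Proof.
move=> [[[[[->|->]|->]|->]|->]|->].
- by exists (a, b, c); rewrite // !inE eqxx ?orbT.
- by exists (b, a, c); rewrite // !inE eqxx ?orbT.
- by exists (c, b, a); rewrite // !inE eqxx ?orbT.
- by exists (a, c, b); rewrite // !inE eqxx ?orbT.
- by exists (b, c, a); rewrite // !inE eqxx ?orbT.
- by exists (c, a, b); rewrite // !inE eqxx ?orbT.
Qed.

Lemma divisor_orbit6 t : t \in S3_orbit (a, b, c) ->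
  exists2 V, orbit6 f V & has_divisor V t.
Proof.
rewrite !inE => /or4P[|||/or3P[]] /eqP->.
- by exists f => //; do 5!left.
- by exists (1 - f) => //; do 4!left; right.
- by exists (1 / f) => //; do 3!left; right.
- by exists (f / (f - 1)) => //; do 2!left; right.
- by exists ((f - 1) / f) => //; left; right.
- by exists (- 1 / (f - 1)) => //; right.
Qed.

End Orbit.

(** Each of the six triples is realised by a member of the orbit, and a function is determined by
    its triple, so no other function has one of them. *)
Lemma orbit6_solutions f t : admissible t -> has_divisor f t ->
  orbit6 f = solutions [:: t].
Proof.
case: t => [[a b] c] adm ft; rewrite /solutions.
apply/seteqP; split=> V; first exact: orbit6_divisor.
move=> [t t_in Vt]; have [V' V'f V't] := divisor_orbit6 ft t_in.
by rewrite (has_divisor_fun i2 (admissible_S3_orbit adm t_in) Vt V't).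
Qed.

Lemma solutions_cat ts ts' : solutions (ts ++ ts') = solutions ts `|` solutions ts'.
Proof.
apply/seteqP; split=> V; rewrite /solutions /= map_cat flatten_cat.
  by move=> [t]; rewrite mem_cat => /orP[]; [left|right]; exists t.
by move=> [[t t_in Vt]|[t t_in Vt]]; exists t; rewrite // mem_cat t_in ?orbT.
Qed.

Lemma solutions_nil : solutions [::] = set0.
Proof. by apply/seteqP; split=> // V []. Qed.

Lemma tofrac_pol e : size e = 5%N -> (pol i e)%:F = monomial x I e.
Proof.
move: e => [|e0 [|e1 [|e2 [|e3 [|e4 []]]]]] // _.
rewrite /pol /pts !polz_cons polz_nil /monomial /= mulr1 polyC0 subr0 !polyCN !opprK polyC1.
by rewrite !tofracM !tofracXn !tofracB !tofracD !tofrac1 !mulrA.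
Qed.

Lemma ratconst_gauss c : gauss I c = ratconst (c.1%:~R + c.2%:~R * i).
Proof. by rewrite /gauss /ratconst !(rmorphD, rmorphM, rmorph_int) /=. Qed.

Lemma gauss_neq0 (c : int * int) : c != (0, 0) -> c.1%:~R + c.2%:~R * i != 0.
Proof.
case: c => u v; apply: contraNneq => /= uv0.
have : zi_val i (Z_of_int u, Z_of_int v) = 0.
  by rewrite /zi_val /= !Z_of_intK mulrC.
move/(zi_val_eq0 i2); rewrite /zi_is0 /= => /andP[/Z.eqb_eq u0 /Z.eqb_eq v0].
by rewrite -[u]Z_of_intK -[v]Z_of_intK u0 v0.
Qed.

Lemma row_has_divisor r t : admissible t -> row_divisor x I r t -> has_divisor r.1.1 t.
Proof.
case/and5P=> /eqP s0 /eqP s1 /eqP s2 _ _ [A0 B0].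
rewrite -!tofrac_pol // !ratconst_gauss => fA fB.
by exists (r.1.2.1%:~R + r.1.2.2%:~R * i), (r.2.1%:~R + r.2.2%:~R * i);
  split; rewrite ?gauss_neq0.
Qed.

Fixpoint orbits (rs : seq (orbit_row {fraction {poly F}})) : set {fraction {poly F}} :=
  if rs is r :: rs' then orbit6 r.1.1 `|` orbits rs' else set0.

Lemma orbits_solutions rs ts : all admissible ts -> rows_divisors x I rs ts ->
  orbits rs = solutions ts.
Proof.
elim: ts rs => [|t ts IHts] [|r rs] //=; first by rewrite solutions_nil.
move=> /andP[adm adms] [rt rsts]; rewrite IHts // -[in RHS]cat1s solutions_cat.
by rewrite (orbit6_solutions adm (row_has_divisor adm rt)).
Qed.

(** Realising every triple makes the number of triples a lower bound for the number of functions as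
    well. *)
Lemma rows_solvable rs ts t : all admissible ts -> rows_divisors x I rs ts ->
  t \in flatten (map S3_orbit ts) -> exists V, has_divisor V t.
Proof.
elim: ts rs => [|t' ts IHts] [|r rs] //= /andP[adm adms] [rt rsts].
rewrite mem_cat => /orP[t_in|]; last exact: IHts adms rsts.
case: t' adm rt t_in => [[a b] c] adm rt t_in.
by have [V _ ?] := divisor_orbit6 (row_has_divisor adm rt) t_in; exists V.
Qed.

Lemma orbits_cat rs rs' : orbits (rs ++ rs') = orbits rs `|` orbits rs'.
Proof. by elim: rs => [|r rs IHrs] /=; rewrite ?set0U // IHrs setUA. Qed.

Lemma orbits_cat8 r1 r2 r3 r4 r5 r6 r7 r8 :
  orbits (r1 ++ r2 ++ r3 ++ r4 ++ r5 ++ r6 ++ r7 ++ r8) =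
  orbits r1 `|` orbits r2 `|` orbits r3 `|` orbits r4
  `|` orbits r5 `|` orbits r6 `|` orbits r7 `|` orbits r8.
Proof. by rewrite !orbits_cat !setUA. Qed.

Lemma admissible_base_triples : all admissible base_triples.
Proof. by vm_compute. Qed.

Lemma admissible_unital_triples t : t \in unital_triples -> admissible t.
Proof.
case/flatten_mapP=> t' t'_in; apply: admissible_S3_orbit.
exact: (allP admissible_base_triples).
Qed.

Lemma unital4E : @unital_set F 4 = solutions base_triples.
Proof.
apply/seteqP; split=> V; first exact: unital_has_divisor.
by case=> t /admissible_unital_triples adm; apply: has_divisor_unital.
Qed.

(** [g k] is a function with the [k]-th triple. It is injective since a function has one triple and
    the triples are distinct, and surjective since a triple has one function. *)
Lemma card_unital4 : @unital_set F 4 #= `I_252.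
Proof.
pose g k := xget 0 [set V | has_divisor V (nth ([::], [::], [::]) unital_triples k)].
have in_triples k : (k < 252)%N -> nth ([::], [::], [::]) unital_triples k \in unital_triples.
  by move=> lt_k; rewrite mem_nth ?size_unital_triples.
have gP k : (k < 252)%N -> has_divisor (g k) (nth ([::], [::], [::]) unital_triples k).
  move=> lt_k; apply: (@xgetPex _ 0 [set V | has_divisor V _]).
  exact: rows_solvable admissible_base_triples (rowsP ratconst_i2 ratX_generic) (in_triples k lt_k).
suff /Pbij[h _] : set_bij `I_252 (@unital_set F 4) g.
  by rewrite card_eq_sym; apply: pcard_eq h.
split=> /=.
- move=> k lt_k; apply: (has_divisor_unital i2 _ (gP k lt_k)).
  exact/admissible_unital_triples/in_triples.
- move=> j k; rewrite !inE => lt_j lt_k eq_g; apply/eqP.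
  rewrite -(nth_uniq ([::], [::], [::]) _ _ uniq_unital_triples) ?size_unital_triples //.
  apply/eqP; apply: (has_divisor_inj i2 _ _ (gP j lt_j)).
  + exact/admissible_unital_triples/in_triples.
  + exact/admissible_unital_triples/in_triples.
  + by rewrite eq_g; apply: gP.
move=> V; rewrite unital4E => -[t t_in Vt]; have lt_t : (index t unital_triples < 252)%N.
  by rewrite -size_unital_triples index_mem.
exists (index t unital_triples) => //; have := gP _ lt_t; rewrite nth_index // => gt.
exact: (has_divisor_fun i2 (admissible_unital_triples t_in) gt Vt).
Qed.

End Solutions.

(** * Matching the stated unions with the lists of rows *)

Section UnionShapes.
Variables (T J : Type) (a b c d : J) (f g h k : J -> set T).

(** The right-hand sides here have the shape to which [orbits] computes on a list of rows, final
    [set0] included. *)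
Lemma bigcup2U3 : \bigcup_(e in [set a; b]) (f e `|` g e `|` h e) =
  f a `|` (g a `|` (h a `|` (f b `|` (g b `|` (h b `|` set0))))).
Proof. by rewrite bigcup_setU !bigcup_set1 setU0 !setUA. Qed.

Lemma bigcup2U4 : \bigcup_(e in [set a; b]) (f e `|` g e `|` h e `|` k e) =
  f a `|` (g a `|` (h a `|` (k a `|` (f b `|` (g b `|` (h b `|` (k b `|` set0))))))).
Proof. by rewrite bigcup_setU !bigcup_set1 setU0 !setUA. Qed.

Lemma bigcup4U3 : \bigcup_(e in [set a; b; c; d]) (f e `|` g e `|` h e) =
  f a `|` (g a `|` (h a `|` (f b `|` (g b `|` (h b `|`
  (f c `|` (g c `|` (h c `|` (f d `|` (g d `|` (h d `|` set0))))))))))).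
Proof. by rewrite !bigcup_setU !bigcup_set1 setU0 !setUA. Qed.

Lemma setU4nil (A B C D : set T) :
  A `|` B `|` C `|` D = A `|` (B `|` (C `|` (D `|` set0))).
Proof. by rewrite setU0 !setUA. Qed.

Lemma setU3nil (A B C : set T) : A `|` B `|` C = A `|` (B `|` (C `|` set0)).
Proof. by rewrite setU0 !setUA. Qed.

Lemma setU2nil (A B : set T) : A `|` B = A `|` (B `|` set0).
Proof. by rewrite setU0. Qed.

End UnionShapes.

Section PaperOrbits.
Variable R : realType.
Local Notation x := (ratX R[i]).
Local Notation I := (@ratconst R[i] 'i%C).

Lemma O_x_rows : O_x R = orbits (rows_x x I).
Proof. exact: bigcup4U3. Qed.

Lemma O_x2_rows : O_x2 R = orbits (rows_x2 x I).
Proof. exact: bigcup2U3. Qed.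

Lemma O_x4_rows : O_x4 R = orbits (rows_x4 x I).
Proof. exact: setU3nil. Qed.

Lemma O_2x_x2p1_rows : O_2x_x2p1 R = orbits (rows_2x_x2p1 x I).
Proof. exact: bigcup2U3. Qed.

Lemma orbit_4x2_rows : orbit_4x2 R = orbits (rows_4x2 x).
Proof. exact/esym/setU0. Qed.

Lemma O_2x_xp1_rows : O_2x_xp1 R = orbits (rows_2x_xp1 x I).
Proof. exact: bigcup2U4. Qed.

Lemma O_xxm1_x2p1_rows : O_xxm1_x2p1 R = orbits (rows_xxm1_x2p1 x I).
Proof. exact: setU4nil. Qed.

Lemma O_2x_xp1xpi_rows : O_2x_xp1xpi R = orbits (rows_2x_xp1xpi x I).
Proof. exact: setU2nil. Qed.

End PaperOrbits.

Theorem theorem2p1 (R : realType) :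
  (@unital_set R[i] 4 #= `I_252) /\
  @unital_set R[i] 4 =
    O_x R `|` O_x2 R `|` O_x4 R `|` O_2x_x2p1 R `|` orbit_4x2 R
    `|` O_2x_xp1 R `|` O_xxm1_x2p1 R `|` O_2x_xp1xpi R.
Proof.
have i2 : ('i%C : R[i]) ^+ 2 = -1 by exact: sqr_i.
split; first exact: card_unital4 i2.
have rows_ok := rowsP (ratconst_i2 i2) (ratX_generic 'i%C).
rewrite (unital4E i2) -(orbits_solutions i2 admissible_base_triples rows_ok).
rewrite O_x_rows O_x2_rows O_x4_rows O_2x_x2p1_rows orbit_4x2_rows.
rewrite O_2x_xp1_rows O_xxm1_x2p1_rows O_2x_xp1xpi_rows.
exact: orbits_cat8.
Qed.
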